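(* If a Hausdorff space $X$ is countably tight and has an $\omega^\omega$-base, then $|X|\le d(X)^\omega$ and $|X|\le 2^{aL_c(X)}\le 2^{L(X)}$. If, in addition, $X$ is regular, then $|X|\le 2^{wL_c(X)}\le 2^{c(X)}$.
   Context: $X$ has an $\omega^\omega$-base if each point $x\in X$ has a neighborhood base $(V_\alpha)_{\alpha\in\omega^\omega}$ with $V_\beta\subset V_\alpha$ for all $\alpha\le\beta$ in the coordinatewise order on $\omega^\omega$. $X$ is countably tight if for every $A\subset X$ and $x\in\overline A$ there is a countable $B\subset A$ with $x\in\overline B$. $d(X)$ is the smallest cardinality of a dense subset of $X$. $L(X)$ is the smallest cardinal $\kappa$ such that each open cover of $X$ has a subcover of cardinality $\le\kappa$. $aL_c(X)$ (resp. $wL_c(X)$) is the smallest cardinal $\kappa$ such that for any cover $\mathcal V$ of a closed subspace $C\subset X$ by open subsets of $X$ there is $\mathcal V'\subset\mathcal V$ with $|\mathcal V'|\le\kappa$ and $C\subset\bigcup_{V\in\mathcal V'}\overline V$ (resp. $C\subset\overline{\bigcup\mathcal V'}$). $c(X)$ is the smallest cardinal $\kappa$ such that every disjoint family of non-empty open subsets of $X$ has cardinality $\le\kappa$. *)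

(* Defs.v *)
From HB Require Import structures.
From mathcomp Require Import all_boot.
From mathcomp Require Import boolp classical_sets functions cardinality.
From mathcomp Require Import filter topology.

Set Implicit Arguments.
Unset Strict Implicit.
Unset Printing Implicit Defensive.

Local Open Scope classical_set_scope.
Local Open Scope card_scope.

(* There is no type of cardinals in the library: a cardinal is represented by
   a set up to [#=].  [P] is a property of cardinals, and [least_card U P] is
   a set of least cardinality, among the sets over all types, with this
   property.  It is looked for inside [U], so [U] must be large enough for
   [P [set: U]] to hold; see [least_cardP]. *)
Definition least_card (U : Type) (P : forall T : Type, set T -> Prop) : set U :=
  get [set K : set U |
        P U K /\ forall (T : Type) (K' : set T), P T K' -> K #<= K'].
Arguments least_card U P : clear implicits.

Lemma inj_card_set (T U : Type) (A : set T) (B : set U) (f : T -> U) :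
  (forall x, A x -> B (f x)) ->
  (forall x y, A x -> A y -> f x = f y -> x = y) -> A #<= B.
Proof.
move=> fAB fI; have [g] : $|{injfun A >-> B}|.
  apply/injfunPex; exists f => // x y /set_mem Ax /set_mem Ay; exact: fI.
exact: inj_card_le g.
Qed.

Lemma card_min_exists (U : Type) (Q : set (set U)) : Q !=set0 ->
  exists2 K, Q K & forall K', Q K' -> K #<= K'.
Proof.
case=> K1 QK1.
(* systems of simultaneous partial injections between the members of Q *)
pose P := [set S : set (set U -> U) |
  (forall f, S f -> forall K, Q K -> K (f K)) /\
  (forall f g, S f -> S g -> forall K, Q K -> f K = g K -> f = g)].
have [|S [[SK SI] Smax]] := @Zorn_bigcup _ P.
  move=> F FP Ftot; split=> [f [S FS Sf] K QK|].
    by have [PS _] := FP _ FS; exact: (PS f Sf K QK).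
  move=> f g [S FS Sf] [S' FS' Sg] K QK.
  have [SS'|S'S] := Ftot _ _ FS FS'.
    by have [_ PS] := FP _ FS'; apply: PS => //; exact: SS'.
  by have [_ PS] := FP _ FS; apply: PS => //; exact: S'S.
have [K0 QK0 K0S] :
    exists2 K, Q K & forall x, K x -> exists2 f, S f & f K = x.
  apply: contrapT => noK.
  have H K : exists x, Q K -> K x /\ forall f, S f -> f K <> x.
    have [QK|nQK] := pselect (Q K); last first.
      have [x _] : exists x : U, True.
        have [[x _]|nx] := pselect (exists x, K1 x); first by exists x.
        by exfalso; apply: noK; exists K1 => // x K1x; case: nx; exists x.
      by exists x.
    apply: contrapT => nx; apply: noK; exists K => // x Kx.
    apply: contrapT => nf; apply: nx; exists x => _; split=> // f Sf fx.
    by apply: nf; exists f.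
  have [g gP] := choice H.
  apply: (Smax (S `|` [set g])).
    split=> [|SgS]; first by move=> f; left.
    by have := (gP K1 QK1).2 g (SgS _ (or_intror erefl)).
  split=> [f [Sf|->] K QK|f h [Sf|->] [Sh|->] K QK //].
  - exact: (SK f Sf K QK).
  - by case: (gP K QK).
  - exact: (SI f h Sf Sh K QK).
  - by move=> e; case: ((gP K QK).2 f Sf e).
  - by move=> e; case: ((gP K QK).2 h Sh (esym e)).
exists K0 => // K' QK'.
have H x : exists f : set U -> U, K0 x -> S f /\ f K0 = x.
  have [/K0S[f Sf fx]|nx] := pselect (K0 x); first by exists f.
  by exists (fun=> x).
have [t tP] := choice H.
apply: (@inj_card_set _ _ _ _ (fun x => t x K')) => [x /tP[Sx _]|x y xK yK e].
  exact: (SK _ Sx K' QK').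
have [Sx ex] := tP _ xK; have [Sy ey] := tP _ yK.
by rewrite -ex -ey (SI _ _ Sx Sy K' QK' e).
Qed.

Lemma card_le_total (T U : Type) (A : set T) (B : set U) :
  A #<= B \/ B #<= A.
Proof.
have eA : (@inl T U @` A) #= A by apply: inj_card_eq => x y _ _ [].
have eB : (@inr T U @` B) #= B by apply: inj_card_eq => x y _ _ [].
have [K [->|->] leK] := @card_min_exists (T + U)%type
    [set K | K = @inl T U @` A \/ K = @inr T U @` B]
    (ex_intro _ _ (or_introl erefl)).
- left; move: (leK _ (or_intror erefl)).
  by rewrite (card_le_eql eA) (card_le_eqr eB).
- right; move: (leK _ (or_introl erefl)).
  by rewrite (card_le_eql eB) (card_le_eqr eA).
Qed.

Lemma least_cardP (U : Type) (P : forall T : Type, set T -> Prop) :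
    (forall (T T' : Type) (K : set T) (K' : set T'), K #= K' -> P T K -> P T' K') ->
    (exists K : set U, P U K) ->
  P U (least_card U P) /\
  forall (T : Type) (K' : set T), P T K' -> least_card U P #<= K'.
Proof.
move=> Peq Pne.
have [K PK Kmin] := @card_min_exists U (P U) Pne.
suff H : exists K : set U, P U K /\
    forall (T : Type) (K' : set T), P T K' -> K #<= K'.
  by have := getPex H.
exists K; split=> // T K' PK'.
have [K'U|UK'] := card_le_total K' [set: U]; last first.
  exact: card_le_trans (card_leT K) UK'.
have [K'' eK] : exists K'' : set U, K' #= K''.
  have /card_leP[g] := K'U; exists ((fun k => val (g k)) @` [set: K']).
  rewrite -(card_eql (card_setT K')) card_eq_sym; apply: inj_card_eq.
  by move=> x y _ _ /val_inj; apply: inj; exact: in_setT.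
rewrite (card_le_eqr eK); apply: Kmin.
exact: Peq eK PK'.
Qed.

(* For a property of the form "something is bounded by the cardinal", the least
   cardinal is characterized by the cardinals above it. *)
Lemma least_card_le (U : Type) (P : forall T : Type, set T -> Prop) :
    (forall (T T' : Type) (K : set T) (K' : set T'), K #<= K' -> P T K -> P T' K') ->
    P U [set: U] ->
  forall (T : Type) (K : set T), least_card U P #<= K <-> P T K.
Proof.
move=> Ple PU T K.
have [||PL Lmin] := @least_cardP U P.
- by move=> T1 T2 K1 K2; rewrite card_eq_le => /andP[le12 _]; exact: Ple.
- by exists [set: U].
by split=> [leK|]; [exact: Ple PL | exact: Lmin].
Qed.

Section Spaces.
Variable X : topologicalType.

Definition omega_omega_base : Prop :=
  forall x : X, exists V : (nat -> nat) -> set X,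
    [/\ forall a, nbhs x (V a),
        forall W, nbhs x W -> exists a, V a `<=` W &
        forall a b, (forall n, a n <= b n) -> V b `<=` V a].

Definition countably_tight : Prop :=
  forall (A : set X) (x : X), closure A x ->
    exists B : set X, [/\ B `<=` A, countable B & closure B x].

Definition open_cover_of (C : set X) (F : set (set X)) : Prop :=
  (forall V, F V -> open V) /\ C `<=` \bigcup_(V in F) V.

Definition dense_card (T : Type) (K : set T) : Prop :=
  exists2 D : set X, dense D & D #= K.

Definition lindelof_bound (T : Type) (K : set T) : Prop :=
  forall F, open_cover_of [set: X] F ->
    exists G, [/\ G `<=` F, G #<= K & [set: X] `<=` \bigcup_(V in G) V].

Definition almost_lindelof_bound (T : Type) (K : set T) : Prop :=
  forall (C : set X) F, closed C -> open_cover_of C F ->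
    exists G, [/\ G `<=` F, G #<= K & C `<=` \bigcup_(V in G) closure V].

Definition weak_lindelof_bound (T : Type) (K : set T) : Prop :=
  forall (C : set X) F, closed C -> open_cover_of C F ->
    exists G, [/\ G `<=` F, G #<= K & C `<=` closure (\bigcup_(V in G) V)].

Definition cellular_bound (T : Type) (K : set T) : Prop :=
  forall F : set (set X), (forall V, F V -> open V /\ V !=set0) ->
    trivIset F id -> F #<= K.

(* d(X), L(X), aL_c(X), wL_c(X) and c(X) *)
Definition density : set X := least_card X dense_card.
Definition lindelof_number : set (set X) := least_card (set X) lindelof_bound.
Definition almost_lindelof_number : set (set X) :=
  least_card (set X) almost_lindelof_bound.
Definition weak_lindelof_number : set (set X) :=
  least_card (set X) weak_lindelof_bound.
Definition cellularity : set (set X) := least_card (set X) cellular_bound.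

Lemma densityP : dense_card density /\
  forall D : set X, dense D -> density #<= D.
Proof.
have [||dP dmin] := @least_cardP X dense_card.
- by move=> T T' K K' KK' [D dD DK]; exists D => //; exact: card_eq_trans KK'.
- exists setT, setT; last exact: card_eqxx.
  by move=> O [x Ox] _; exists x.
by split=> // D dD; apply: dmin; exists D => //; exact: card_eqxx.
Qed.

Lemma lindelof_numberP (T : Type) (K : set T) :
  lindelof_number #<= K <-> lindelof_bound K.
Proof.
apply: least_card_le => [T1 T2 K1 K2 le12 P1 F oF|F oF].
  have [G [GF GK GC]] := P1 F oF.
  by exists G; split=> //; exact: card_le_trans le12.
by exists F; split=> //; [exact: card_leT | exact: oF.2].
Qed.

Lemma almost_lindelof_numberP (T : Type) (K : set T) :
  almost_lindelof_number #<= K <-> almost_lindelof_bound K.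
Proof.
apply: least_card_le => [T1 T2 K1 K2 le12 P1 C F cC oF|C F cC oF].
  have [G [GF GK GC]] := P1 C F cC oF.
  by exists G; split=> //; exact: card_le_trans le12.
exists F; split=> //; first exact: card_leT.
by move=> x /oF.2[V FV Vx]; exists V => //; exact: subset_closure.
Qed.

Lemma weak_lindelof_numberP (T : Type) (K : set T) :
  weak_lindelof_number #<= K <-> weak_lindelof_bound K.
Proof.
apply: least_card_le => [T1 T2 K1 K2 le12 P1 C F cC oF|C F cC oF].
  have [G [GF GK GC]] := P1 C F cC oF.
  by exists G; split=> //; exact: card_le_trans le12.
exists F; split=> //; first exact: card_leT.
by move=> x /oF.2; exact: subset_closure.
Qed.

Lemma cellularityP (T : Type) (K : set T) :
  cellularity #<= K <-> cellular_bound K.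
Proof.
apply: least_card_le => [T1 T2 K1 K2 le12 P1 F oF tF|F oF tF].
  exact: card_le_trans (P1 F oF tF) le12.
exact: card_leT.
Qed.

End Spaces.

Arguments density X : clear implicits.
Arguments lindelof_number X : clear implicits.
Arguments almost_lindelof_number X : clear implicits.
Arguments weak_lindelof_number X : clear implicits.
Arguments cellularity X : clear implicits.

(* Main.v *)
Require Import Defs.
From mathcomp Require Import all_boot.
From mathcomp Require Import boolp classical_sets functions cardinality.
From mathcomp Require Import filter topology.

(** The heart of the matter is that, in a Hausdorff space with an
    [omega^omega]-base [(V_a)] at [x], a sequence [b] accumulating at [x]
    together with one set of pairs (integer, finite sequence) determines [x].
    Put [D_s = {n | b n is in V_a for every a extending s}], for [s] a finite
    sequence of integers. The set of the [n] such that [n] is in [D_(a|k)] for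
    some [k] is clearly contained in [{n | b n is in V_a}], and it also contains
    [{n | b n is in V_a'}] for some [a']: if [b n] is not caught by [D_(a|n)],
    choose [c_n] extending [a|n] with [b n] outside [V_(c_n)]; at each place all
    but finitely many [c_n] agree with [a], so the [c_n] have an upper bound
    [a'], and [V_a'] avoids all the [b n] that are not caught. So the countable
    family [(D_s)] generates the trace on [b] of the neighborhood filter of [x],
    and two points with the same family, one of them a cluster point of [b],
    cannot be separated ([trace_inj]).

    Consequently the closure of a countable set has at most [2^omega] points.
    With countable tightness, every point is coded by a sequence in a dense set
    and a subset of a countable set, which gives [|X| <= d(X)^omega]
    ([card_le_pow_dense]).

    For the bounds by [2^aL_c] and [2^wL_c], let [K] be a cardinal with the
    corresponding covering property. If [K] is finite, then so is [X], since
    finitely many points of a Hausdorff space have disjoint neighborhoods, no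
    one of which can be omitted from a cover. If [K] is infinite, close a point
    of [X] under limits of sequences and under the following operation: given
    [K] many basic neighborhoods of points already obtained, pick a point
    outside the union of their closures (or outside the closure of their union)
    if there is one. Each point has [2^omega <= 2^K] basic neighborhoods, so there
    are [2^K] operations, all of arity [K], and the result [H] has at most [2^K]
    points ([closing_off]). By countable tightness [H] is closed. A point
    [q] outside [H] could be separated from [H] by a cover of [H] by basic
    neighborhoods, [K] many of which would suffice in the sense of the covering
    property; but then the operation would have produced a point of [H] that they
    leave out. So [H = X] ([card_le_set_of_bound]). *)

Local Open Scope classical_set_scope.
Local Open Scope card_scope.

Set Implicit Arguments.
Unset Strict Implicit.

(** * Inequalities between cardinals as injections *)

Lemma card_le_injT (A B : Type) :
  [set: A] #<= [set: B] <-> exists f : A -> B, injective f.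
Proof.
split=> [/card_leP[f]|[f fI]]; last first.
  by apply: (@inj_card_set _ _ _ _ f) => // x y _ _; exact: fI.
exists (fun x => val (f (SigSub (mem_setT x)))) => x y /val_inj.
by move=> /(inj (in_setT _) (in_setT _))[].
Qed.

Lemma card_le_inj_on (T U : Type) (A : set T) (B : set U) (u0 : U) : A #<= B ->
  exists f : T -> U, (forall x, A x -> B (f x)) /\
    forall x y, A x -> A y -> f x = f y -> x = y.
Proof.
rewrite -(card_le_eql (card_setT A)) -(card_le_eqr (card_setT B)).
move=> /card_le_injT[f fI].
pose g x := if pselect (A x) is left Ax then val (f (SigSub (mem_set Ax))) else u0.
exists g; split=> [x Ax|x y Ax Ay]; rewrite /g.
  by case: pselect => // ?; exact/set_mem/valP.
case: pselect => // ?; case: pselect => // ? /val_inj/fI.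
by move=> [].
Qed.

(** * The square of an infinite cardinal *)

Section square.
Variable K : Type.
Implicit Types (S : set ((K * K) * K)) (x y z : K) (p : K * K).

(** The set [A] for which the graph [S] is meant to be an injection of [A * A]
    into [A]; it is read off from [S], so that Zorn's lemma can be applied to
    graphs ordered by inclusion. *)
Let field S x := exists z, S ((x, x), z).

Let square_inj S :=
  [/\ forall p z z', S (p, z) -> S (p, z') -> z = z',
      forall p p' z, S (p, z) -> S (p', z) -> p = p',
      forall p z, S (p, z) -> [/\ field S p.1, field S p.2 & field S z] &
      forall x y, field S x -> field S y -> exists z, S ((x, y), z)].

Lemma square_inj_bigcup (F : set (set ((K * K) * K))) :
    (forall S, F S -> square_inj S) -> total_on F subset ->
  square_inj (\bigcup_(S in F) S).
Proof.
move=> FP Ftot.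
have join S S' : F S -> F S' -> exists2 T, F T & S `<=` T /\ S' `<=` T.
  move=> FS FS'.
  by have [SS'|S'S] := Ftot _ _ FS FS'; [exists S'|exists S] => //; split.
have fieldS S x : F S -> field S x -> field (\bigcup_(S in F) S) x.
  by move=> FS [z Sz]; exists z, S.
split.
- move=> p z z' [S FS Sz] [S' FS' Sz'].
  have [T FT [ST S'T]] := join _ _ FS FS'; have [+ _ _ _] := FP T FT.
  by apply; [exact: ST Sz|exact: S'T Sz'].
- move=> p p' z [S FS Sz] [S' FS' Sz'].
  have [T FT [ST S'T]] := join _ _ FS FS'; have [_ + _ _] := FP T FT.
  by apply; [exact: ST Sz|exact: S'T Sz'].
- move=> p z [S FS Sz]; have [_ _ /(_ _ _ Sz)[? ? ?] _] := FP S FS.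
  by split; exact: (fieldS S).
- move=> x y [z [S FS Sz]] [z' [S' FS' Sz']].
  have [T FT [ST S'T]] := join _ _ FS FS'; have [_ _ _ T4] := FP T FT.
  have [|w Tw] := T4 x y _ (ex_intro _ z' (S'T _ Sz')).
    by exists z; exact: ST.
  by exists w, T.
Qed.

Lemma square_inj_fun S : square_inj S -> exists f : K * K -> K,
  (forall p, field S p.1 -> field S p.2 -> field S (f p)) /\
  (forall p q, field S p.1 -> field S p.2 -> field S q.1 -> field S q.2 ->
    f p = f q -> p = q).
Proof.
move=> [S1 S2 S3 S4].
have [f fS] : exists f : K * K -> K,
    forall p, field S p.1 -> field S p.2 -> S (p, f p).
  suff /choice[f fP] : forall p, exists z,
    field S p.1 -> field S p.2 -> S (p, z) by exists f.
  move=> [x y] /=; have [[Ax Ay]|nA] := pselect (field S x /\ field S y).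
    by have [z Sz] := S4 _ _ Ax Ay; exists z.
  by exists x => Ax Ay; case: nA.
exists f; split=> [p A1 A2|p q p1 p2 q1 q2 e].
  by have [] := S3 _ _ (fS p A1 A2).
by apply: S2 (fS p p1 p2) _; rewrite e; exact: fS.
Qed.

(** [v] maps [A = field S] to a disjoint copy of itself. The new pairs of
    elements of [A + v A] make up three copies of [A * A]; they are mapped
    to [v A] only, where [S] takes no values. *)
Lemma square_inj_extend S (v : K -> K) (a0 a1 : K) :
    square_inj S -> field S a0 -> field S a1 -> a0 <> a1 ->
    (forall x, field S x -> ~ field S (v x)) ->
    (forall x y, field S x -> field S y -> v x = v y -> x = y) ->
  exists S', square_inj S' /\ S `<` S'.
Proof.
move=> SP Aa0 Aa1 a01 vA vI; have [S1 S2 S3 S4] := SP.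
pose A := field S.
have [f [fA fI]] := square_inj_fun SP.
pose B x := A x \/ exists2 a, A a & v a = x.
have [r rP] : exists r : K -> K, forall x, B x ->
    [/\ A (r x), A x -> r x = x & ~ A x -> v (r x) = x].
  suff /choice[r rP] : forall x, exists a,
      B x -> [/\ A a, A x -> a = x & ~ A x -> v a = x] by exists r.
  move=> x; have [Ax|nAx] := pselect (A x); first by exists x.
  have [[//|[a Aa ax]]|nB] := pselect (B x); last by exists x.
  by exists a.
(* [t x] records which of the two copies [x] belongs to *)
pose t x := if `[< A x >] then a0 else a1.
have At x : A (t x) by rewrite /t; case: ifP.
have rtI x y : B x -> B y -> r x = r y -> t x = t y -> x = y.
  move=> /rP[_ rx vx] /rP[_ ry vy] exy; rewrite /t.
  case: asboolP => [Ax|nAx]; case: asboolP => [Ay|nAy] // e.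
  - by rewrite -rx // -ry.
  - by case: a01.
  - by rewrite -vx // -vy // exy.
pose g p := f (f (t p.1, t p.2), f (r p.1, r p.2)).
have rA x : B x -> A (r x) by move=> /rP[].
have gA p : B p.1 -> B p.2 -> A (g p).
  by move=> B1 B2; apply: (fA); apply: (fA); first [exact: At|exact: rA].
have gI p q : B p.1 -> B p.2 -> B q.1 -> B q.2 -> g p = g q -> p = q.
  case: p q => [x y] [x' y'] /= Bx By Bx' By' e.
  have [et er] : f (t x, t y) = f (t x', t y') /\ f (r x, r y) = f (r x', r y').
    suff [] : (f (t x, t y), f (r x, r y)) = (f (t x', t y'), f (r x', r y')) by [].
    by apply: fI e; apply: (fA); first [exact: At|exact: rA].
  have [tx ty] : (t x, t y) = (t x', t y') by apply: fI et; exact: At.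
  have [rx ry] : (r x, r y) = (r x', r y') by apply: fI er; exact: rA.
  by congr pair; exact: rtI.
pose S' := S `|` [set w | [/\ B w.1.1, B w.1.2, ~ (A w.1.1 /\ A w.1.2) &
                              w.2 = v (g w.1)]].
have BE x : field S' x <-> B x.
  split=> [[z [Sz|[]//]]|Bx]; first by left; exists z.
  have [[z Sz]|nAx] := pselect (A x); first by exists z; left.
  by exists (v (g (x, x))); right; split=> //= -[].
exists S'; split; last first.
  split=> [w Sw|]; first by left.
  have nAv := vA _ Aa0; have Bv : B (v a0) by right; exists a0.
  have /BE[z S'z] := Bv; move=> /(_ _ S'z) Sz.
  by apply: nAv; exists z.
split.
- move=> p z z' [Sz|[/= _ _ nA ->]] [Sz'|[/= _ _ nA' ->]] //.
  + exact: S1 Sz Sz'.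
  + by case: nA'; have [] := S3 _ _ Sz.
  + by case: nA; have [] := S3 _ _ Sz'.
- move=> p p' z [Sz|[/= B1 B2 nA ->]] [Sz'|[/= B1' B2' nA' e]].
  + exact: S2 Sz Sz'.
  + have [_ _ Az] := S3 _ _ Sz; case: (vA (g p')); first exact: gA.
    by rewrite -e.
  + have [_ _ Az] := S3 _ _ Sz'; case: (vA (g p)) => //; exact: gA.
  + by apply: gI => //; apply: vI e; exact: gA.
- move=> p z [/S3[A1 A2 A3]|[/= B1 B2 nA ->]]; split; apply/BE => //; try by left.
  by right; exists (g p) => //; exact: gA.
- move=> x y /BE Bx /BE By.
  have [[Ax Ay]|nA] := pselect (A x /\ A y).
    by have [z Sz] := S4 _ _ Ax Ay; exists z; left.
  by exists (v (g (x, y))); right; split.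
Qed.

(** Take a maximal injection [A * A -> A], on an infinite [A]. If the complement
    of [A] were at least as large as [A], the injection could be extended;
    hence it is at most as large as [A], and then [K] injects into [A + A], thus
    into [A * A] and into [A]. *)
Lemma card_square : infinite_set [set: K] -> [set: K * K] #<= [set: K].
Proof.
move=> /infiniteP/card_le_injT[h hI].
pose S0 := [set w : (K * K) * K | exists i j : nat,
  w = ((h i, h j), h (pickle (i, j)))].
have S0f x : field S0 x <-> exists i, x = h i.
  split=> [[z [i [j [-> _ _]]]]|[i ->]]; first by exists i.
  by exists (h (pickle (i, i))), i, i.
have S0P : square_inj S0.
  split.
  - by move=> p z z' [i [j [-> ->]]] [i' [j' [/hI -> /hI -> ->]]].
  - move=> p p' z [i [j [-> ->]]] [i' [j' [->]]].
    by move=> /hI/(pcan_inj pickleK)[-> ->].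
  - by move=> p z [i [j [-> ->]]]; split; apply/S0f; eexists.
  - by move=> x y /S0f[i ->] /S0f[j ->]; exists (h (pickle (i, j))), i, j.
(* Zorn's lemma includes the empty chain, so the empty graph has to be allowed;
   any other one contains [S0], which keeps its field infinite *)
pose P S := square_inj S /\ (S !=set0 -> S0 `<=` S).
have [F FP Ftot|S [[SP S0S] Smax]] := @Zorn_bigcup _ P.
  split=> [|[w [S FS Sw]]]; first by apply: square_inj_bigcup => // S /FP[].
  have [_ S0S] := FP _ FS; apply: subset_trans (S0S _) _; first by exists w.
  by move=> u Su; exists S.
have [S0e|/set0P Sne] := eqVneq S set0.
  exfalso; apply: (Smax S0); last by split=> // _ ?.
  rewrite S0e; split=> // /(_ ((h 0, h 0), h (pickle (0, 0)))).
  by apply; exists 0, 0.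
have {}S0S := S0S Sne.
pose A := field S.
have hA i : A (h i) by exists (h (pickle (i, i))); apply: S0S; exists i, i.
have h01 : h 0 <> h 1 by move=> /hI.
have [AK|KA] := card_le_total A (~` A).
  have [v [vA vI]] := card_le_inj_on (h 0) AK.
  have [S' [S'P [SS' S'S]]] :=
    @square_inj_extend S v _ _ SP (hA 0) (hA 1) h01 vA vI.
  exfalso; apply: (Smax S') => //; split=> // _; exact: subset_trans SS'.
have [u [uA uI]] := card_le_inj_on (h 0) KA.
have [f [fA fI]] := square_inj_fun SP.
pose w x := if pselect (A x) then f (h 0, x) else f (h 1, u x).
have wA x : A (w x).
  rewrite /w; case: pselect => /= Ax; apply: fA => //; first exact: hA.
  - exact: hA.
  - exact: uA.
have wI x y : w x = w y -> x = y.
  have ux z : ~ A z -> field S (u z) by exact: uA.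
  rewrite /w; case: pselect => /= Ax; case: pselect => /= Ay e.
  - by have [] := fI (h 0, x) (h 0, y) (hA 0) Ax (hA 0) Ay e.
  - by have [] := fI (h 0, x) (h 1, u y) (hA 0) Ax (hA 1) (ux _ Ay) e => /h01.
  - by have [] := fI (h 1, u x) (h 0, y) (hA 1) (ux _ Ax) (hA 0) Ay e => /esym/h01.
  - have [] := fI (h 1, u x) (h 1, u y) (hA 1) (ux _ Ax) (hA 1) (ux _ Ay) e.
    by move=> /uI; apply.
apply/card_le_injT; exists (fun p => f (w p.1, w p.2)) => -[x y] [x' y'] e.
have [] : (w x, w y) = (w x', w y') by apply: fI e; exact: wA.
by move=> /wI-> /wI->.
Qed.

End square.

(** * Sets below [K] and below [2^K] *)

Lemma card_prod_le (A B K : Type) : infinite_set [set: K] ->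
  [set: A] #<= [set: K] -> [set: B] #<= [set: K] -> [set: A * B] #<= [set: K].
Proof.
move=> Kinf /card_le_injT[f fI] /card_le_injT[g gI].
apply: card_le_trans (card_square Kinf); apply/card_le_injT.
by exists (fun p => (f p.1, g p.2)) => -[a b] [a' b'] /= [/fI-> /gI->].
Qed.

Lemma card_seq (K : Type) : infinite_set [set: K] -> [set: seq K] #<= [set: K].
Proof.
move=> Kinf; have /infiniteP/card_le_injT[h hI] := Kinf.
have /card_le_injT[f fI] := card_square Kinf.
apply: card_le_trans (card_square Kinf); apply/card_le_injT.
(* the length has to be recorded: [code] is injective only on sequences of the
   same length *)
pose code := foldr (fun x c => f (x, c)) (h 0).
exists (fun s => (h (size s), code s)) => s t [/hI st ct].
elim: s t st ct => [|x s IHs] [|y t] //= [st] /fI[-> ct].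
by rewrite (IHs t).
Qed.

Lemma card_option (K : Type) : infinite_set [set: K] ->
  [set: option K] #<= [set: K].
Proof.
move=> Kinf; apply: card_le_trans (card_seq Kinf); apply/card_le_injT.
by exists (fun m => if m is Some y then [:: y] else [::]) => -[y|] [z|] // [->].
Qed.

Lemma card_set_le (A B : Type) : [set: A] #<= [set: B] ->
  [set: set A] #<= [set: set B].
Proof.
move=> /card_le_injT[f fI]; apply/card_le_injT.
exists (fun S => f @` S) => S T e; apply/funext => a.
by rewrite -(image_inj fI) e image_inj.
Qed.

Lemma card_set_sum (A B K : Type) : infinite_set [set: K] ->
  [set: A] #<= [set: set K] -> [set: B] #<= [set: set K] ->
  [set: A + B] #<= [set: set K].
Proof.
move=> Kinf /card_le_injT[f fI] /card_le_injT[g gI].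
apply: card_le_trans (card_set_le (card_option Kinf)); apply/card_le_injT.
exists (fun u m => match u, m with
  | inl a, Some y => f a y
  | inl _, None => False
  | inr b, Some y => g b y
  | inr _, None => True
  end) => -[a|b] [a'|b'] E.
- by congr inl; apply: fI; apply/funext => y; have := congr1 (@^~ (Some y)) E.
- by exfalso; have /= -> := congr1 (@^~ None) E.
- by exfalso; have /= <- := congr1 (@^~ None) E.
- by congr inr; apply: gI; apply/funext => y; have := congr1 (@^~ (Some y)) E.
Qed.

Lemma card_fun_set (A B : Type) : [set: A -> B] #<= [set: set (A * B)].
Proof.
apply/card_le_injT; exists (fun f => [set p | f p.1 = p.2]) => f g e.
apply/funext => a; have : [set p | g p.1 = p.2] (a, f a) by rewrite -e.
by move=> /= ->.
Qed.

(** * Closing a point under operations of infinite arity *)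

(** The terms built from a constant and operations of arity [K] named by the
    elements of [L]. Induction on terms takes the place of a transfinite iteration
    of length [K^+]. *)
Inductive ctree (L K : Type) :=
| Leaf
| Node of L & (K -> ctree L K).

Section closing_off.
Variables (L K X : Type) (e : L -> set K) (op : L -> (K -> X) -> X) (x0 : X).

(** A term is coded by the labels found along its finite branches, each label
    being given as a subset of [K]; [None] distinguishes a node with an empty
    label from a leaf. *)
Fixpoint tree_code (t : ctree L K) (s : seq K) (m : option K) : Prop :=
  match t with
  | Leaf => False
  | Node l k => match s with
    | [::] => if m is Some y then e l y else True
    | i :: s' => tree_code (k i) s' m
    end
  end.

Lemma tree_code_inj : injective e -> injective tree_code.
Proof.
move=> eI; elim=> [|l k IH] [|l' k'] E //.
- by have : tree_code (Leaf L K) [::] None by rewrite E.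
- by have : tree_code (Leaf L K) [::] None by rewrite -E.
have -> : l = l'.
  apply: eI; apply/funext => y.
  by have := congr1 (fun c => c [::] (Some y)) E.
congr Node; apply/funext => i; apply: IH; apply/funext => s; apply/funext => m.
by have := congr1 (fun c => c (i :: s) m) E.
Qed.

Fixpoint tree_val (t : ctree L K) : X :=
  if t is Node l k then op l (fun i => tree_val (k i)) else x0.

End closing_off.

(** The set of the values of all terms will do: there are no more of them than
    subsets of [seq K * option K], that is, than subsets of [K]. *)
Lemma closing_off (L K X : Type) (op : L -> (K -> X) -> X) (x0 : X) :
    infinite_set [set: K] -> [set: L] #<= [set: set K] ->
  exists H : set X, [/\ H x0,
    forall l x, (forall i, H (x i)) -> H (op l x) & H #<= [set: set K]].
Proof.
move=> Kinf /card_le_injT[e eI].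
exists (range (tree_val op x0)); split.
- by exists (Leaf L K).
- move=> l x Hx; have [k kx] : exists k, forall i, tree_val op x0 (k i) = x i.
    suff /choice[k kx] : forall i, exists t, tree_val op x0 t = x i by exists k.
    by move=> i; have [t _ <-] := Hx i; exists t.
  by exists (Node l k) => //=; congr op; apply/funext => i; rewrite kx.
apply: card_le_trans (card_image_le _ _) _.
apply: (@card_le_trans _ _ _ [set: set (seq K * option K)]).
  apply/card_le_injT; exists (fun t => [set p | tree_code e t p.1 p.2]) => t u E.
  apply: (tree_code_inj eI); apply/funext => s; apply/funext => m.
  by have := congr1 (@^~ (s, m)) E.
apply/card_set_le/card_prod_le => //; first exact: card_seq.
exact: card_option.
Qed.

(** * Recovering a point from its trace on a sequence *)

(** Lifts an enumeration by [K] of a set of images to the points of [H]; the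
    indices that are left over are sent to some point of [H], hence [H !=set0]. *)
Lemma image_enum (T U K : Type) (f : T -> U) (H : set T) (G : set U) :
    H !=set0 -> G `<=` f @` H -> G #<= [set: K] ->
  exists x : K -> T, (forall i, H (x i)) /\ G `<=` range (f \o x).
Proof.
move=> [y0 Hy0] GH; rewrite -(card_le_eql (card_setT G)).
move=> /card_le_injT[e eI].
have [x xP] : exists x : K -> T,
    forall i, H (x i) /\ forall v : G, e v = i -> f (x i) = val v.
  suff /choice[x xP] : forall i, exists y,
    H y /\ forall v : G, e v = i -> f y = val v by exists x.
  move=> i; have [[v ev]|nv] := pselect (exists v, e v = i); last first.
    by exists y0; split=> // v ev; case: nv; exists v.
  have [y Hy fy] := GH _ (set_mem (valP v)).
  by exists y; split=> // w; rewrite -ev => /eI->.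
exists x; split=> [i|v Gv]; first by have [] := xP i.
have [_ xv] := xP (e (SigSub (mem_set Gv))).
by exists (e (SigSub (mem_set Gv))) => //=; rewrite (xv _ erefl).
Qed.

Section trace.
Variables (X : topologicalType) (V : X -> (nat -> nat) -> set X).
Hypothesis VP : forall x, [/\ forall a, nbhs x (V x a),
  forall W, nbhs x W -> exists a, V x a `<=` W &
  forall a b, (forall n, a n <= b n) -> V x b `<=` V x a].

Let V_nbhs x a : nbhs x (V x a). Proof. by have [] := VP x. Qed.
Let V_base x W : nbhs x W -> exists a, V x a `<=` W.
Proof. by have [_ + _] := VP x; apply. Qed.
Let V_anti x a b : (forall n, a n <= b n) -> V x b `<=` V x a.
Proof. by have [_ _] := VP x; apply. Qed.

(** The sets [D_s] as a single set of pairs [(n, s)]: a finite sequence [s] stands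
    for the basic open set of its extensions in the Baire space, over which the
    [V x a] are intersected. *)
Definition trace (b : nat -> X) (x : X) : set (nat * seq nat) :=
  [set p | forall a, mkseq a (size p.2) = p.2 -> V x a (b p.1)].

Lemma trace_sub b x a n k : trace b x (n, mkseq a k) -> V x a (b n).
Proof. by apply => /=; rewrite size_mkseq. Qed.

(** If no pair [(n, mkseq a k)] is in the trace, some [c n] agreeing with [a]
    below [n] has [b n] outside [V x (c n)]. Only finitely many of the [c n]
    may differ from [a] at a given place, so they have an upper bound [a'], and
    [V x a'] contains no such [b n]. *)
Lemma sub_trace b x a : exists a', forall n, V x a' (b n) ->
  exists k, trace b x (n, mkseq a k).
Proof.
have [c cP] : exists c : nat -> nat -> nat, forall n,
    mkseq (c n) n = mkseq a n /\
    (V x (c n) (b n) -> exists k, trace b x (n, mkseq a k)).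
  suff /choice[c cP] : forall n, exists d, mkseq d n = mkseq a n /\
    (V x d (b n) -> exists k, trace b x (n, mkseq a k)) by exists c.
  move=> n; have [tn|] := pselect (trace b x (n, mkseq a n)).
    by exists a; split=> // _; exists n.
  move=> /existsNP[d /not_implyP[]] /=; rewrite size_mkseq => da nVd.
  by exists d.
(* at [m], the term [a m] bounds the [c n] with [m < n], the maximum the others *)
exists (fun m => a m + \max_(n < m.+1) c n m) => n Vn.
have [cn] := cP n; apply; apply: V_anti Vn => m.
have [mn|nm] := ltnP m n.
  rewrite -[c n m](nth_mkseq 0 (c n) mn) cn nth_mkseq //; exact: leq_addr.
apply: leq_trans (leq_addl _ _).
exact: (leq_bigmax (Ordinal (nm : n < m.+1))).
Qed.

(** A basic neighborhood of [x] meets the sequence in a [b n] caught by the common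
    trace, and such a [b n] lies in given neighborhoods of both [x] and [y]. *)
Lemma trace_inj b x y : hausdorff_space X ->
  closure (range b) x -> trace b x = trace b y -> x = y.
Proof.
move=> hX xb xy; apply: hX => A B xA yB.
have [a aA] := V_base xA; have [c cB] := V_base yB.
pose d n := maxn (a n) (c n).
have [d' d'P] := sub_trace b x d.
have [_ [[n _ <-] /d'P[k tk]]] := xb _ (V_nbhs x d').
exists (b n); split.
  apply: aA; apply: V_anti (trace_sub tk) => m; exact: leq_maxl.
rewrite xy in tk.
apply: cB; apply: V_anti (trace_sub tk) => m; exact: leq_maxr.
Qed.

End trace.

Lemma closure_seq (X : topologicalType) (A : set X) (x : X) :
    countably_tight X -> closure A x ->
  exists b : nat -> X, (forall n, A (b n)) /\ closure (range b) x.
Proof.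
move=> tX Ax; have [y [Ay _]] := Ax _ (filterT : nbhs x setT).
have [B [BA Bc Bx]] := tX A x Ax.
have [||b [bA Bb]] := @image_enum X X nat id A B _ _ Bc; first by exists y.
  by move=> z Bz; exists z => //; exact: BA.
by exists b; split=> //; exact: closure_subset Bx.
Qed.

(** A point is coded by a sequence in [D] that accumulates at it and by its trace
    on this sequence. Two distinct elements of [D] serve as the bits of the
    trace; if there are none, [X] has at most one point. *)
Lemma card_le_pow_dense (X : topologicalType) (D : set X) :
    hausdorff_space X -> countably_tight X -> omega_omega_base X -> dense D ->
  [set: X] #<= [set: nat -> D].
Proof.
move=> hX tX /choice[V VP] dD.
have [b bP] : exists b : X -> nat -> D, forall x, closure (range (val \o b x)) x.
  suff /choice[b bP] : forall x, exists b : nat -> D,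
    closure (range (val \o b)) x by exists b.
  move=> x; have Dx : closure D x.
    move=> B /nbhs_interior xB; rewrite setIC.
    have Bne : interior B !=set0 by exists x; exact: nbhs_singleton.
    have [z [/interior_subset Bz Dz]] := dD _ Bne (open_interior B).
    by exists z.
  have [b [bD bx]] := closure_seq tX Dx.
  exists (fun n => SigSub (mem_set (bD n))).
  exact: bx.
have [[d0 [d1 d01]]|D1] := pselect (exists d0 d1 : D, d0 <> d1); last first.
  apply/card_le_injT; exists b => x y _; apply: contrapT => /eqP xy.
  move: hX; rewrite open_hausdorff => /(_ x y xy)[[A B] /= [xA yB] [oA oB]].
  have [u [Au Du]] := dD _ (ex_intro _ x (set_mem xA)) oA.
  have [v [Bv Dv]] := dD _ (ex_intro _ y (set_mem yB)) oB.
  move=> /eqP/seteqP[/(_ u) + _]; apply; split=> //.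
  suff /(congr1 val)/= -> : SigSub (mem_set Du) = SigSub (mem_set Dv) :> D by [].
  by apply: contrapT => uv; apply: D1; eexists; eexists; exact: uv.
apply/card_le_injT.
pose t x := trace V (val \o b x) x.
pose h x (u : nat + nat * seq nat) :=
  match u with inl n => b x n | inr p => if `[< t x p >] then d1 else d0 end.
have hI : injective h.
  move=> x y e.
  have bxy : b x = b y.
    by apply/funext => n; have := congr1 (@^~ (inl n)) e.
  apply: (trace_inj VP hX (bP x)); suff : t x = t y by rewrite /t bxy.
  apply/funext => p; apply/propext.
  have := congr1 (@^~ (inr p)) e => /=.
  by case: asboolP => tx; case: asboolP => ty // d; split=> // _; case: d01.
exists (fun x n => if unpickle n is Some u then h x u else d0) => x y e.
apply: hI; apply/funext => u.
by have := congr1 (@^~ (pickle u)) e; rewrite pickleK.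
Qed.

(** * Comparison of the covering numbers *)

Lemma almost_weak_lindelof (X : topologicalType) (T : Type) (K : set T) :
  almost_lindelof_bound X K -> weak_lindelof_bound X K.
Proof.
move=> aK C F Ccl FC; have [G [GF GK CG]] := aK C F Ccl FC.
exists G; split=> // x /CG[W GW]; apply: closure_subset => z Wz.
by exists W.
Qed.

Lemma lindelof_almost_lindelof (X : topologicalType) (T : Type) (K : set T) :
  lindelof_bound X K -> almost_lindelof_bound X K.
Proof.
move=> lK C F Ccl [Fo CF].
have [|G [GF GK XG]] := lK (F `|` [set ~` C]).
  split=> [W [/Fo//|->]|x _]; first exact: closed_openC.
  have [/CF[W FW Wx]|nCx] := pselect (C x); first by exists W => //; left.
  by exists (~` C) => //; right.
exists (G `&` F); split=> [W []//||x Cx].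
  by apply: card_le_trans GK; apply: subset_card_le => W [].
have [W GW Wx] := XG x I; exists W; last exact: subset_closure.
by split=> //; have [//|/= WC] := GF _ GW; rewrite WC in Wx.
Qed.

(** Take a maximal disjoint family of non-empty open sets each contained in a
    member of the cover, and for each of them one such member. By maximality
    the union of the chosen members is dense in that of the cover. *)
Lemma cellular_weak_lindelof (X : topologicalType) (T : Type) (K : set T) :
  cellular_bound X K -> weak_lindelof_bound X K.
Proof.
move=> cK C F Ccl [Fo CF].
pose P := [set E : set (set X) |
  (forall W, E W -> [/\ open W, W !=set0 & exists2 U, F U & W `<=` U]) /\
  trivIset E id].
have [E EP Etot|E [[EP Etriv] Emax]] := @Zorn_bigcup _ P.
  split=> [W [D /EP[DP _]]|]; first exact: DP.
  move=> W W' [D ED DW] [D' ED' DW'] WW'.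
  have [DD'|D'D] := Etot _ _ ED ED'.
    by have [_] := EP _ ED'; apply=> //; exact: DD'.
  by have [_] := EP _ ED; apply=> //; exact: D'D.
have EK : E #<= K by apply: cK => // W /EP[].
have [u uP] : exists u : set X -> set X, forall W, E W -> F (u W) /\ W `<=` u W.
  suff /choice[u uP] : forall W, exists U, E W -> F U /\ W `<=` U by exists u.
  move=> W; have [/EP[_ _ [U FU WU]]|nE] := pselect (E W); first by exists U.
  by exists W.
exists (u @` E); split=> [_ [W /uP[FW _] <-]//||x Cx B /nbhs_interior xB].
  exact: card_le_trans (card_image_le _ _) EK.
have [U FU Ux] := CF x Cx; apply: contrapT => nB.
pose W := interior B `&` U.
have Wx : W x by split=> //; exact: nbhs_singleton xB.
have WE D z : E D -> D z -> W z -> False.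
  move=> ED Dz [/interior_subset Bz _]; apply: nB; exists z; split=> //.
  by exists (u D); [exists D | have [_] := uP D ED; exact].
apply: (Emax (E `|` [set W])).
  split=> [D ED|/(_ W (or_intror erefl)) EW]; first by left.
  exact: (WE W x EW Wx Wx).
split=> [D [/EP//|->]|D D' [ED|->] [ED'|->] [z [Dz D'z]] //].
- split; last by exists U => // z [].
    by apply: openI; [exact: open_interior | exact: Fo].
  by exists x.
- by apply: Etriv => //; exists z.
- by case: (WE D z).
- by case: (WE D' z).
Qed.

(** * Finite covering numbers *)

(** Cover [S] by disjoint open neighborhoods of its points: each member is then
    indispensable, even up to closure. *)
Lemma weak_lindelof_finite (X : topologicalType) (T : Type) (K : set T)
    (S : set X) :
    hausdorff_space X -> weak_lindelof_bound X K -> finite_set S -> S #<= K.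
Proof.
move=> hX wK Sfin.
have Scl : closed S.
  by apply: (accessible_finite_set_closed.1 _ S Sfin); exact: hausdorff_accessible.
have [U UP] : exists U : X * X -> set X * set X, forall p, p.1 <> p.2 ->
    [/\ nbhs p.1 (U p).1, nbhs p.2 (U p).2 & (U p).1 `&` (U p).2 = set0].
  suff /choice[U UP] : forall p : X * X, exists U : set X * set X, p.1 <> p.2 ->
    [/\ nbhs p.1 U.1, nbhs p.2 U.2 & U.1 `&` U.2 = set0] by exists U.
  move=> [x y] /=; have [->|xy] := eqVneq x y; first by exists (setT, setT).
  move: hX; rewrite open_hausdorff => /(_ x y xy)[U [xU yU] [oU1 oU2 /eqP U0]].
  exists U => _; split=> //; apply: open_nbhs_nbhs; split=> //; exact: set_mem.
pose N x := \bigcap_(y in S)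
  (if x == y then setT else (U (x, y)).1 `&` (U (y, x)).2).
have Nx x : nbhs x (N x).
  have [D SD] := finite_fsetP.1 Sfin; rewrite /N SD.
  apply: filter_bigI => y _; case: eqP => [_|xy]; first exact: filterT.
  apply: filterI; first by have [] := UP (x, y) xy.
  by have [] := UP (y, x) (nesym xy).
pose O x := interior (N x).
have Ox x : O x x by apply: nbhs_singleton; exact: nbhs_interior.
have OI x y z : S x -> S y -> O x z -> O y z -> x = y.
  move=> Sx Sy /interior_subset/(_ y Sy) + /interior_subset/(_ x Sx).
  case: eqP => // xy [xyz _]; case: eqP => [|_ [_ yxz]]; first by move=> ->.
  have [_ _ U0] := UP (x, y) xy.
  by have : set0 z by rewrite -U0.
have [|G [GO GK SG]] := wK S (O @` S) Scl.
  split=> [_ [x _ <-]|x Sx]; first exact: open_interior.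
  by exists (O x) => //; exists x.
apply: card_le_trans GK; apply: (inj_card_set (f := O)) => [x Sx|x y Sx Sy e].
  have xO : nbhs x (O x) by exact: nbhs_interior.
  have [z [[W GW Wz] Oz]] := SG x Sx _ xO.
  have [y Sy yW] := GO _ GW; rewrite -yW in Wz GW.
  by rewrite (OI x y z).
by apply: (OI x y x) => //; rewrite -e.
Qed.

(** An infinite [X] would have a finite subset with more points than [K]. *)
Lemma card_le_finite_bound (X : topologicalType) (K : Type) :
    hausdorff_space X -> weak_lindelof_bound X [set: K] -> finite_set [set: K] ->
  [set: X] #<= [set: set K].
Proof.
move=> hX wK Kfin.
have Xfin : finite_set [set: X].
  apply: contrapT => /infiniteP/card_le_injT[f fI].
  have [n Kn] := (finite_setP _).1 Kfin.
  have fn : f @` `I_n.+1 #<= [set: K].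
    by apply: (weak_lindelof_finite hX wK); exact/finite_image/finite_II.
  have : `I_n.+1 #<= `I_n.
    rewrite -(card_le_eqr Kn); apply: card_le_trans fn.
    by apply: (inj_card_set (f := f)) => [x Ix|x y _ _ /fI //]; exists x.
  by rewrite card_le_II ltnn.
apply: card_le_trans (weak_lindelof_finite hX wK Xfin) _.
by apply/card_le_injT; exists set1 => x y /seteqP[/(_ x erefl)].
Qed.

(** * Spaces with a covering property *)

Section closing_off_space.
Variables (X : topologicalType) (K : Type).
(** [Phi G] is the part of the space that [G] counts as covering: the union of the
    closures of its members, or the closure of their union. *)
Variable Phi : set (set X) -> set X.
Hypothesis hX : hausdorff_space X.
Hypothesis tX : countably_tight X.
Variable V : X -> (nat -> nat) -> set X.
Hypothesis VP : forall x, [/\ forall a, nbhs x (V x a),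
  forall W, nbhs x W -> exists a, V x a `<=` W &
  forall a b, (forall n, a n <= b n) -> V x b `<=` V x a].
Hypothesis Phi_mono : forall F G, F `<=` G -> Phi F `<=` Phi G.
Hypothesis Phi_separates : forall C q, closed C -> ~ C q ->
  exists a : X -> nat -> nat, ~ Phi [set interior (V x (a x)) | x in C] q.
Hypothesis Phi_bound : forall C F, closed C -> open_cover_of C F ->
  exists G, [/\ G `<=` F, G #<= [set: K] & C `<=` Phi G].

(** Close a point under limits of sequences, found again from their traces, and
    under the choice of a point not covered by [K] many basic neighborhoods. The
    set obtained is closed, has at most [2^K] points, and nothing is left outside:
    a point [q] outside would be separated from it by basic neighborhoods [K] many
    of which cover it, whereas [q] shows that these do not cover [X], so that they
    also miss some point of the set. *)
Lemma card_le_set_of_bound : infinite_set [set: K] -> [set: X] #<= [set: set K].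
Proof.
move=> Kinf; have /infiniteP natK := Kinf.
have [[x0 _]|X0] := pselect (exists x : X, True); last first.
  apply/card_le_injT; have f (x : X) : set K by case: X0; exists x.
  by exists f => x; case: X0; exists x.
have [h hI] := (card_le_injT _ _).1 natK.
(* the operations have arity [K]: a sequence is an argument read along [h], and
   [g] turns a sequence into an argument *)
have [g hK] : exists g : K -> nat, cancel h g.
  suff /choice[g gP] : forall k, exists n, forall m, h m = k -> m = n.
    by exists g => n; rewrite -(gP (h n) n).
  move=> k; have [[n <-]|nk] := pselect (exists n, h n = k).
    by exists n => m /hI.
  by exists 0 => m hm; case: nk; exists m.
pose L := (set (nat * seq nat) + (K * nat -> nat))%type.
pose spec (u : L) (x : K -> X) (y : X) := match u with
  | inl c => forall z, closure (range (x \o h)) z -> trace V (x \o h) z = c -> y = z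
  | inr a => let F := range (fun i => interior (V (x i) (fun n => a (i, n)))) in
      (exists z, ~ Phi F z) -> ~ Phi F y
  end.
have [op opP] : exists op : L -> (K -> X) -> X, forall u x, spec u x (op u x).
  suff /choice[op opP] : forall p : L * (K -> X), exists y, spec p.1 p.2 y.
    by exists (fun u x => op (u, x)) => u x; exact: (opP (u, x)).
  move=> [[c|a] x] /=.
    have [[y [yx yc]]|ny] := pselect (exists y,
        closure (range (x \o h)) y /\ trace V (x \o h) y = c).
      exists y => z zx zc.
      by apply: (trace_inj VP hX yx); rewrite yc zc.
    by exists x0 => z zx zc; case: ny; exists z.
  have [[z Fz]|nF] := pselect (exists z,
      ~ Phi (range (fun i => interior (V (x i) (fun n => a (i, n))))) z).
    by exists z.
  by exists x0.
have LK : [set: L] #<= [set: set K].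
  apply: card_set_sum => //.
    by apply/card_set_le; apply: card_le_trans natK; exact: countableP.
  apply: card_le_trans (card_fun_set _ _) _; apply: card_set_le.
  by do 2?[apply: card_prod_le => //]; exact: card_lexx.
have [H [Hx0 Hop HK]] := closing_off op x0 Kinf LK.
have Hcl : closed H.
  move=> z /(closure_seq tX)[b [bH bz]].
  have xh : (b \o g) \o h = b by apply/funext => n /=; rewrite hK.
  have <- : op (inl (trace V b z)) (b \o g) = z.
    by have := opP (inl (trace V b z)) (b \o g) z; rewrite xh; exact.
  by apply: Hop => i; exact: bH.
suff -> : [set: X] = H by [].
apply/seteqP; split=> // q _; apply: contrapT => nHq.
have [a naq] := Phi_separates Hcl nHq.
have [|G [GF GK HG]] := @Phi_bound H [set interior (V x (a x)) | x in H] Hcl.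
  split=> [_ [x _ <-]|x Hx]; first exact: open_interior.
  have Vn y : nbhs y (V y (a y)) by have [] := VP y.
  exists (interior (V x (a x))); first by exists x.
  exact: nbhs_singleton (nbhs_interior (Vn x)).
have [x [xH Gx]] := image_enum (ex_intro _ x0 Hx0) GF GK.
pose c p := a (x p.1) p.2.
have := opP (inr c) x => /=; set F := [set _ | _ in _] => opF.
suff : Phi F (op (inr c) x).
  apply: opF; exists q; apply: contra_not naq; apply: Phi_mono.
  by move=> _ [i _ <-]; exists (x i).
by apply: Phi_mono Gx _ (HG _ (Hop _ _ xH)).
Qed.

End closing_off_space.

Lemma card_le_set_almost_lindelof (X : topologicalType) (K : Type) :
    hausdorff_space X -> countably_tight X -> omega_omega_base X ->
  almost_lindelof_bound X [set: K] -> [set: X] #<= [set: set K].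
Proof.
move=> hX tX /choice[V VP] aK.
have [Kfin|Kinf] := pselect (finite_set [set: K]).
  exact/(card_le_finite_bound hX _ Kfin)/almost_weak_lindelof.
apply: (@card_le_set_of_bound X K
  (fun G => \bigcup_(W in G) closure W) hX tX V VP) => //.
- by move=> F G FG x [W /FG GW Wx]; exists W.
move=> C q _ nCq.
have [a aP] : exists a : X -> nat -> nat, forall x, x <> q ->
    ~ closure (V x (a x)) q.
  suff /choice[a aP] : forall x, exists a, x <> q -> ~ closure (V x a) q.
    by exists a.
  move=> x; have [->|xq] := eqVneq x q; first by exists (fun=> 0).
  move: hX; rewrite open_hausdorff => /(_ x q xq)[U [xU qU] [oU1 oU2 /eqP U0]].
  have [_ + _] := VP x => /(_ U.1)[|a aU].
    by apply: open_nbhs_nbhs; split=> //; exact: set_mem.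
  exists a => _ /(_ U.2)[|z [/aU U1z U2z]].
    by apply: open_nbhs_nbhs; split=> //; exact: set_mem.
  by have : set0 z by rewrite -U0.
exists a => -[_ [x Cx <-] /(closure_subset (@interior_subset _ _))].
by apply: aP => xq; apply: nCq; rewrite -xq.
Qed.

(** Regularity separates [q] from a closed set [C] by a neighborhood [U] of [q]
    and neighborhoods of the points of [C] that are all disjoint from the same
    [U]; so [q] is not even in the closure of their union. *)
Lemma card_le_set_weak_lindelof (X : topologicalType) (K : Type) :
    hausdorff_space X -> countably_tight X -> omega_omega_base X ->
    regular_space X ->
  weak_lindelof_bound X [set: K] -> [set: X] #<= [set: set K].
Proof.
move=> hX tX /choice[V VP] rX wK.
have [Kfin|Kinf] := pselect (finite_set [set: K]).
  exact: card_le_finite_bound.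
apply: (@card_le_set_of_bound X K
  (fun G => closure (\bigcup_(W in G) W)) hX tX V VP) => //.
- by move=> F G FG; apply: closure_subset => x [W /FG GW Wx]; exists W.
move=> C q Ccl nCq.
have [U qU UC] : exists2 U, nbhs q U & closure U `<=` ~` C.
  by apply: rX; apply: open_nbhs_nbhs; split=> //; exact: closed_openC.
have [a aP] : exists a : X -> nat -> nat, forall x, C x ->
    U `&` V x (a x) = set0.
  suff /choice[a aP] : forall x, exists a, C x -> U `&` V x a = set0.
    by exists a.
  move=> x; have [Cx|nCx] := pselect (C x); last by exists (fun=> 0).
  have : ~ closure U x by move=> /UC.
  move=> /existsNP[B /not_implyP[xB UB]].
  have [_ + _] := VP x => /(_ B xB)[a aB]; exists a => _.
  by apply/seteqP; split=> // z [Uz /aB Bz]; apply: UB; exists z.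
exists a => /(_ U qU)[z [[_ [x Cx <-] /interior_subset Vz] Uz]].
by have : set0 z by rewrite -(aP x Cx).
Qed.

Unset Implicit Arguments.

(* For a cardinal [K], [[set: nat -> K]] has cardinality [K ^ omega] and
   [[set: set K]] has cardinality [2 ^ K]. *)
Theorem theorem8p4 (X : topologicalType) (X_hausdorff : hausdorff_space X)
    (X_tight : countably_tight X) (X_base : omega_omega_base X) :
  [/\ [set: X] #<= [set: nat -> density X],
      [set: X] #<= [set: set (almost_lindelof_number X)],
      [set: set (almost_lindelof_number X)] #<= [set: set (lindelof_number X)] &
      regular_space X ->
        [set: X] #<= [set: set (weak_lindelof_number X)] /\
        [set: set (weak_lindelof_number X)] #<= [set: set (cellularity X)]].
Proof.
have leT T (K : set T) : K #<= [set: K].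
  by rewrite (card_le_eqr (card_setT K)) card_lexx.
have set_le T U (K : set T) (K' : set U) :
    K #<= K' -> [set: set K] #<= [set: set K'].
  move=> KK'; apply: card_set_le.
  by rewrite (card_le_eql (card_setT K)) (card_le_eqr (card_setT K')).
split.
- have [[D dD DX] _] := densityP X.
  apply: card_le_trans (card_le_pow_dense X_hausdorff X_tight X_base dD) _.
  have /card_le_injT[e eI] : [set: D] #<= [set: density X].
    rewrite (card_le_eql (card_setT D)) (card_le_eqr (card_setT _)).
    by rewrite (card_le_eql DX) card_lexx.
  apply/card_le_injT; exists (fun b => e \o b) => b c bc.
  by apply/funext => n; apply: eI; exact: (congr1 (@^~ n) bc).
- by apply: card_le_set_almost_lindelof => //; apply/almost_lindelof_numberP.
- apply/set_le/almost_lindelof_numberP/lindelof_almost_lindelof.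
  by apply/lindelof_numberP; exact: card_lexx.
- move=> rX; split.
    by apply: card_le_set_weak_lindelof => //; apply/weak_lindelof_numberP.
  apply/set_le/weak_lindelof_numberP/cellular_weak_lindelof.
  by apply/cellularityP; exact: card_lexx.
Qed.
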